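(* Let $\mathcal{A}$ be a BT partition sort algorithm that sorts the permutation $\pi$ of $\{1,\dots,n\}$ using $\mathcal{A}(\pi)$ accesses, and let $\mathrm{OPT}_{\mathrm{BST}}(\pi)$ be the optimal cost of querying $\pi$ with a BST algorithm. Then $\mathrm{OPT}_{\mathrm{BST}}(\pi)\in O(\mathcal{A}(\pi))$.
   Context: BST model: keys $\{1,\dots,n\}$ stored in a BST; an access sequence is served in order, each search starting at the root and at each step moving the pointer to the parent or a child or rotating the current node with its parent, each at unit cost; the search must visit its key. $\mathrm{OPT}_{\mathrm{BST}}(\pi)$ is the minimum cost of an offline BST algorithm serving $\pi$. A top tree of a binary tree $T$ is a connected set of nodes containing the root. BT partition: given a binary tree (BT) $T$ (not key-ordered; its left-to-right order of keys represents input order), for some top tree $\tau$ of $T$ it returns two nonempty BTs $T_A,T_B$ with distinct keys such that for some top trees $\tau_a$ of $T_A$, $\tau_b$ of $T_B$, $\tau=\tau_a\cup\tau_b$, the other subtrees of $T$ appear unchanged in $T_A$ or $T_B$, $\tau$ contains the block boundaries (blocks: maximal contiguous runs, in the left-to-right order of $T$, of keys sent to the same output; boundaries: their first and last keys), and the left-to-right orders of keys in $T_A$ and in $T_B$ are subsequences of that in $T$. Number of accesses: $|\tau|$. BT partition sort: on a BT of size one it stops; otherwise it BT-partitions $T$ into $T_a,T_b$ such that for some key $k$ all keys in $T_a$ are $<k$ and all keys in $T_b$ are $\ge k$, recurses on each, and appends the results. It sorts $\pi$ when started on a BT whose left-to-right order of keys is $\pi$. Number of accesses: the sum over all partitions.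 *)

(* Defs.v *)
From Stdlib Require List.
From mathcomp Require Import all_boot.
Set Implicit Arguments. Unset Strict Implicit. Unset Printing Implicit Defensive.

Inductive bt := Leaf | Node of bt & nat & bt.

Fixpoint inorder (t : bt) : seq nat :=
  match t with Leaf => [::] | Node l k r => inorder l ++ k :: inorder r end.

Inductive subtree (u : bt) : bt -> Prop :=
| sub_refl : subtree u u
| sub_l l k r : subtree u l -> subtree u (Node l k r)
| sub_r l k r : subtree u r -> subtree u (Node l k r).

(* Top trees: a connected set of nodes containing the root, described *)
(* by its shape (a prefix-closed set of positions).                    *)
Inductive shape := SLeaf | SNode of shape & shape.

Fixpoint fits (s : shape) (t : bt) : bool :=
  match s, t with
  | SLeaf, _ => true
  | SNode sl sr, Node l _ r => fits sl l && fits sr r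
  | SNode _ _, Leaf => false
  end.

Definition top_tree (s : shape) (t : bt) : bool :=
  if s is SNode _ _ then fits s t else false.

Fixpoint topkeys (s : shape) (t : bt) : seq nat :=
  match s, t with
  | SNode sl sr, Node l k r => topkeys sl l ++ k :: topkeys sr r
  | _, _ => [::]
  end.

Fixpoint hang (s : shape) (t : bt) : seq bt :=
  match s with
  | SLeaf => [:: t]
  | SNode sl sr =>
      match t with Node l _ r => hang sl l ++ hang sr r | Leaf => [::] end
  end.

(* position i of s is a block boundary w.r.t. the side function f:
   first or last key of a maximal run of keys with the same side *)
Definition boundary (f : nat -> bool) (s : seq nat) (i : nat) : bool :=
  (i < size s) &&
  [|| i == 0, f (nth 0 s i.-1) != f (nth 0 s i),
      i.+1 == size s | f (nth 0 s i.+1) != f (nth 0 s i)].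

Definition btpart (T : bt) (tau : shape) (TA TB : bt) : Prop :=
  top_tree tau T /\ TA <> Leaf /\ TB <> Leaf /\
  (forall x, x \in inorder TA -> x \notin inorder TB) /\
  (exists ta tb : shape,
     [/\ top_tree ta TA, top_tree tb TB,
         (forall x, (x \in topkeys tau T) =
                    (x \in topkeys ta TA) || (x \in topkeys tb TB)) &
         (forall u, List.In u (hang tau T) -> u <> Leaf ->
                    subtree u TA \/ subtree u TB)]) /\
  (forall i, boundary (fun x => x \in inorder TA) (inorder T) i ->
             nth 0 (inorder T) i \in topkeys tau T) /\
  subseq (inorder TA) (inorder T) /\ subseq (inorder TB) (inorder T).

(* ptsort T a : some run of BT partition sort started on T uses a accesses *)
Inductive ptsort : bt -> nat -> Prop :=
| ps_one k : ptsort (Node Leaf k Leaf) 0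
| ps_split T tau TA TB k ca cb :
    btpart T tau TA TB ->
    (forall x, x \in inorder TA -> x < k) ->
    (forall x, x \in inorder TB -> k <= x) ->
    ptsort TA ca -> ptsort TB cb ->
    ptsort T (size (topkeys tau T) + ca + cb).

(* BST model. Positions are paths from the root (false = left).       *)
Fixpoint sub_at (t : bt) (p : seq bool) : bt :=
  match p with
  | [::] => t
  | b :: p' => match t with
               | Leaf => Leaf
               | Node l _ r => sub_at (if b then r else l) p'
               end
  end.

Fixpoint upd_at (t : bt) (p : seq bool) (u : bt) : bt :=
  match p with
  | [::] => u
  | b :: p' => match t with
               | Leaf => Leaf
               | Node l k r => if b then Node l k (upd_at r p' u)
                               else Node (upd_at l p' u) k r
               end
  end.

Definition rot_child (b : bool) (t : bt) : bt :=
  match b, t with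
  | false, Node (Node a x c) y d => Node a x (Node c y d)
  | true, Node a y (Node c x d) => Node (Node a y c) x d
  | _, _ => t
  end.

Inductive step : bt -> seq bool -> bt -> seq bool -> Prop :=
| st_up t q b : sub_at t (rcons q b) <> Leaf -> step t (rcons q b) t q
| st_down t p b l k r : sub_at t p = Node l k r ->
    (if b then r else l) <> Leaf -> step t p t (rcons p b)
| st_rot t q b : sub_at t (rcons q b) <> Leaf ->
    step t (rcons q b) (upd_at t q (rot_child b (sub_at t q))) q.

Inductive walk : bt -> seq bool -> nat -> bt -> seq bool -> Prop :=
| w0 t p : walk t p 0 t p
| wS t p t1 p1 c t2 p2 : step t p t1 p1 -> walk t1 p1 c t2 p2 ->
    walk t p c.+1 t2 p2.

Definition search (t : bt) (x : nat) (c : nat) (t' : bt) : Prop :=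
  exists c1 c2 t1 p1 p2,
    [/\ walk t [::] c1 t1 p1, (exists l r, sub_at t1 p1 = Node l x r),
        walk t1 p1 c2 t' p2 & c = c1 + c2].

Inductive serve : bt -> seq nat -> nat -> Prop :=
| sv_nil t : serve t [::] 0
| sv_cons t x s c1 t1 c2 : search t x c1 t1 -> serve t1 s c2 ->
    serve t (x :: s) (c1 + c2).

(* OPT_BST(pi) <= b over keys {1..n}: some offline BST algorithm
   (initial BST on {1..n} and sequence of operations) serves pi at cost <= b *)
Definition opt_bst_le (n : nat) (pi : seq nat) (b : nat) : Prop :=
  exists t0, inorder t0 = iota 1 n /\ exists c, serve t0 pi c /\ c <= b.

(* Main.v *)
(* Geometric view of BST execution. A partition of the keys in the value interval
   [lo, hi) at the split value k, touching tau, contributes the points (c, y) for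
   c in {lo, k, hi} and y in tau: at the time key y is accessed, column c is
   touched. Together with the points (x, x) of the singleton trees these are at
   most 3 a + n points, and they form an arborally satisfied set. By induction on
   the sort: two points whose keys go to different sides are separated by a block
   boundary, which is touched; if the keys go to the same side, their lowest
   common ancestor there is touched as soon as one of them is, and an untouched
   pair keeps its ancestry relation because hanging subtrees survive intact.
   The BST is kept a treap ordered by next touch time. The columns touched now
   form a top tree, which is rotated into a right spine and then into the top tree
   of the treap for the next access, at cost linear in its size; satisfaction says
   that the subtrees hanging below it still respect the new heap order. *)
Require Import Defs.
From Stdlib Require List.
From mathcomp Require Import all_boot zify.
Set Implicit Arguments. Unset Strict Implicit. Unset Printing Implicit Defensive.

(** * Ancestors, top trees and block boundaries *)

Lemma subtree_Node u l k r : subtree u (Node l k r) ->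
  [\/ u = Node l k r, subtree u l | subtree u r].
Proof.
by move=> h; inversion h; subst; [constructor 1|constructor 2|constructor 3].
Qed.

Lemma subtree_trans u v t : subtree u v -> subtree v t -> subtree u t.
Proof. by move=> uv; elim=> // *; [apply: sub_l|apply: sub_r]. Qed.

Lemma subtree_inorder u t : subtree u t -> {subset inorder u <= inorder t}.
Proof.
elim=> //= l k r _ IH x /IH xi; rewrite mem_cat in_cons xi ?orbT //.
Qed.

Lemma mem_subtree (x : nat) t : x \in inorder t -> exists l r, subtree (Node l x r) t.
Proof.
elim: t => //= l IHl k r IHr; rewrite mem_cat in_cons => /or3P[].
- by case/IHl => l' [r' h]; exists l', r'; apply: sub_l.
- by move=> /eqP ->; exists l, r; apply: Defs.sub_refl.
- by case/IHr => l' [r' h]; exists l', r'; apply: sub_r.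
Qed.

Lemma topkeys_inorder s t : {subset topkeys s t <= inorder t}.
Proof.
elim: t s => [|l IHl k r IHr] [|sl sr] //= x.
rewrite !mem_cat !in_cons => /or3P[/IHl ->|->|/IHr ->] //; rewrite ?orbT //.
Qed.

(** Ancestry is weak: a key is its own ancestor. Phrased through [subtree], it carries over to any
    tree containing a hanging subtree intact. *)
Definition anc (t : bt) (x y : nat) : Prop :=
  exists l r, subtree (Node l x r) t /\ y \in inorder (Node l x r).

Lemma anc_mem t x y : anc t x y -> x \in inorder t /\ y \in inorder t.
Proof.
case=> l [r [/subtree_inorder s yi]]; split; apply: s => //=.
by rewrite mem_cat mem_head orbT.
Qed.

Lemma topkeys_anc t s x y : uniq (inorder t) -> anc t x y ->
  y \in topkeys s t -> x \in topkeys s t.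
Proof.
move=> + [l [r [+ yi]]].
elim: t s => [|tl IHl k tr IHr] [|sl sr] //=.
rewrite cat_uniq /= negb_or => /and4P[ul /andP[kl /hasPn rl] kr ur] /subtree_Node.
rewrite !mem_cat !in_cons => -[[_ -> _] _|sub|sub].
- by rewrite eqxx orbT.
- have yl := subtree_inorder sub yi.
  case/or3P=> [h|/eqP e|/topkeys_inorder /rl].
  + by rewrite (IHl sl).
  + by rewrite -e yl in kl.
  + by rewrite yl.
- have yr := subtree_inorder sub yi.
  case/or3P=> [/topkeys_inorder h|/eqP e|h].
  + by move: (rl _ yr); rewrite /= h.
  + by rewrite -e yr in kr.
  + by rewrite (IHr sr) ?orbT.
Qed.

Lemma subtree_hang t s l x r : fits s t -> x \notin topkeys s t ->
  subtree (Node l x r) t ->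
  exists u, [/\ List.In u (hang s t), u <> Leaf & subtree (Node l x r) u].
Proof.
elim: t s => [|tl IHl k tr IHr] [|sl sr] //=.
- by move=> _ _ h; inversion h.
- by move=> _ _ h; exists (Node tl k tr); split=> //; left.
case/andP=> fl fr; rewrite mem_cat in_cons !negb_or.
case/and3P=> xl /eqP xk xr /subtree_Node[[_ /xk//]|/IHl|/IHr].
- case/(_ _ fl xl) => u [i n h]; exists u; split=> //.
  by apply: List.in_or_app; left.
- case/(_ _ fr xr) => u [i n h]; exists u; split=> //.
  by apply: List.in_or_app; right.
Qed.

(** Serves rows, with [f] the access time, and columns, with [f = id]; two points may come in either
    order, so the ends are unordered. *)
Definition between (f : nat -> nat) (a z b : nat) : bool :=
  (f a <= f z <= f b) || (f b <= f z <= f a).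

Lemma betweenC f a z b : between f a z b = between f b z a.
Proof. by rewrite /between orbC. Qed.

Definition increasing (f : nat -> nat) : seq nat -> bool :=
  pairwise (fun x y => f x < f y).

Lemma increasing_uniq f s : increasing f s -> uniq s.
Proof. by apply: pairwise_uniq => x; rewrite ltnn. Qed.

Lemma increasing_nth f s i j : increasing f s -> i <= j < size s ->
  f (nth 0 s i) <= f (nth 0 s j).
Proof.
move=> /(pairwiseP 0) h /andP[]; rewrite leq_eqVlt => /predU1P[->//|ij] js.
by apply: ltnW; apply: h => //; rewrite inE; apply: leq_trans js; apply: ltnW.
Qed.

(* The witness [y] is the lowest common ancestor of [a] and [b]. *)
Lemma common_ancestor f t a b : increasing f (inorder t) ->
  a \in inorder t -> b \in inorder t ->
  exists y, [/\ anc t y a, anc t y b & between f a y b].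
Proof.
elim: t => //= l IHl k r IHr; rewrite /increasing pairwise_cat /= -/(increasing f _).
rewrite -/(increasing f _) => /and3P[/allrelP lkr il /andP[/allP kr ir]] ai bi.
have kk : forall x, x \in inorder l ++ k :: inorder r -> anc (Node l k r) k x.
  by move=> x xi; exists l, r; split=> //; apply: Defs.sub_refl.
have lk x : x \in inorder l -> f x < f k by move=> /lkr; apply; rewrite mem_head.
move: (ai) (bi); rewrite !mem_cat !in_cons.
case/or3P=> [al|/eqP ea|ar]; case/or3P=> [bl|/eqP eb|br];
  try by exists k; split; [exact: kk|exact: kk|];
    subst; rewrite /between ?leqnn //;
    (try have /ltnW -> := lk _ al); (try have /ltnW -> := lk _ bl);
    (try have /ltnW -> := kr _ ar); (try have /ltnW -> := kr _ br);
    rewrite ?leqnn ?orbT.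
- have [y [[l1 [r1 [h1 m1]]] [l2 [r2 [h2 m2]]] bt]] := IHl il al bl.
  exists y; split=> //; [exists l1, r1|exists l2, r2]; split=> //; exact: sub_l.
- have [y [[l1 [r1 [h1 m1]]] [l2 [r2 [h2 m2]]] bt]] := IHr ir ar br.
  exists y; split=> //; [exists l1, r1|exists l2, r2]; split=> //; exact: sub_r.
Qed.

Lemma switch_exists (g : nat -> bool) i j : i < j -> g i != g j ->
  exists2 m, i < m <= j & g m.-1 != g m.
Proof.
elim: j => // j IH; rewrite ltnS leq_eqVlt => /predU1P[->|ij] gij.
  by exists j.+1; rewrite ?ltnSn ?leqnn.
have [e|ne] := eqVneq (g j) (g j.+1); last by exists j.+1; rewrite // ltnS leqnn ltnW.
have [m /andP[im mj] gm] := IH ij ltac:(by rewrite e).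
by exists m; rewrite // im leqW.
Qed.

(** Both keys adjacent to a switch of sides are boundaries; the one towards [b] is chosen, so that
    it differs from [a]. *)
Lemma boundary_between f (g : nat -> bool) s a b : increasing f s ->
  a \in s -> b \in s -> g a != g b ->
  exists z i, [/\ z = nth 0 s i, boundary g s i, z <> a & between f a z b].
Proof.
move=> inc ai bi gab.
have us := increasing_uniq inc.
have [i ia ea] : exists2 i, i < size s & nth 0 s i = a by apply/nthP.
have [j ib eb] : exists2 j, j < size s & nth 0 s j = b by apply/nthP.
have [ij|ji|e] := ltngtP i j; last by rewrite -ea -eb e eqxx in gab.
- have [m /andP[im mj] gm] := @switch_exists (fun n => g (nth 0 s n)) _ _ ij
    ltac:(by rewrite /= ea eb).
  have ms : m < size s by apply: leq_ltn_trans ib.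
  exists (nth 0 s m), m; split=> //.
  + by rewrite /boundary ms gm orbT.
  + move/eqP; rewrite -ea nth_uniq // => /eqP e; lia.
  + by rewrite -ea -eb; apply/orP; left; rewrite !(increasing_nth inc) //; lia.
- have [m /andP[jm mi] gm] := @switch_exists (fun n => g (nth 0 s n)) _ _ ji
    ltac:(by rewrite /= ea eb eq_sym).
  have ms : m < size s by apply: leq_ltn_trans ia.
  case: m jm mi gm ms => // m jm mi gm ms.
  exists (nth 0 s m), m; split=> //.
  + have gm' : g (nth 0 s m.+1) != g (nth 0 s m) by rewrite eq_sym.
    by rewrite /boundary (ltnW ms) gm' !orbT.
  + move/eqP; rewrite -ea nth_uniq // ?(ltnW ms) // => /eqP e; lia.
  + by rewrite -ea -eb; apply/orP; right; rewrite !(increasing_nth inc) //; lia.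
Qed.

(** * A satisfied point set from a partition sort *)

(* What the points-and-columns argument uses of a partition [btpart T s TA TB]
   with touched keys [tau]. *)
Record cut (f : nat -> nat) (T TA TB : bt) (tau : seq nat) : Prop := Cut {
  cut_mem (x : nat) : (x \in inorder T) = (x \in inorder TA) || (x \in inorder TB);
  cut_disjoint (x : nat) : x \in inorder TA -> x \in inorder TB -> False;
  cut_tau : {subset tau <= inorder T};
  cut_anc (x y : nat) : anc T x y -> y \in tau -> x \in tau;
  cut_ancA (x y : nat) : anc TA x y -> y \in tau -> x \in tau;
  cut_ancB (x y : nat) : anc TB x y -> y \in tau -> x \in tau;
  cut_hang (x y : nat) : anc T x y -> x \notin tau -> anc TA x y \/ anc TB x y;
  cut_switchA (a b : nat) : a \in inorder TA -> b \in inorder TB ->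
    exists z : nat, [/\ z \in tau, z <> a & between f a z b];
  cut_switchB (a b : nat) : a \in inorder TA -> b \in inorder TB ->
    exists z : nat, [/\ z \in tau, z <> b & between f a z b] }.

Lemma btpart_cut f T s TA TB : increasing f (inorder T) ->
  btpart T s TA TB -> cut f T TA TB (topkeys s T).
Proof.
move=> inc [tT [_ [_ [dis [[ta [tb [tA tB ttau hang_sub]]] [bnd [subA subB]]]]]]].
have uT := increasing_uniq inc.
have sA := mem_subseq subA; have sB := mem_subseq subB.
have fT : fits s T by case: (s) tT.
have keep x y : anc T x y -> x \notin topkeys s T -> anc TA x y \/ anc TB x y.
  case=> l [r [sub yi]] xn.
  have [u [ui /(hang_sub _ ui) su sn]] := subtree_hang fT xn sub.
  case: su => su; [left|right]; exists l, r; split=> //; exact: subtree_trans su.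
have switch a b : a \in inorder T -> b \in inorder T ->
    (a \in inorder TA) != (b \in inorder TA) ->
    exists z, [/\ z \in topkeys s T, z <> a & between f a z b].
  move=> aT bT ab.
  have [z [i [-> bi za btw]]] :=
    @boundary_between f (fun x => x \in inorder TA) _ _ _ inc aT bT ab.
  by exists (nth 0 (inorder T) i); split=> //; apply: bnd.
have dis' b : b \in inorder TB -> b \in inorder TA = false.
  by move=> bB; apply/negbTE/negP => /dis; rewrite bB.
split=> //.
(* A touched key lies in an output top tree, an untouched one in a hanging subtree that survives. *)
- move=> x; apply/idP/orP; last by case=> [/sA|/sB].
  move=> xT; have [|xn] := boolP (x \in topkeys s T).
    by rewrite ttau => /orP[] /topkeys_inorder ->; [left|right].
  have [l [r sub]] := mem_subtree xT.
  have [|/anc_mem[->]|/anc_mem[->]] := @keep x x _ xn; [|by left|by right].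
  by exists l, r; split=> //=; rewrite mem_cat mem_head orbT.
- by move=> x /dis/negP.
- exact: topkeys_inorder.
- by move=> x y; apply: topkeys_anc.
- move=> x y xy; have [xA yA] := anc_mem xy; rewrite !ttau => /orP[yt|/topkeys_inorder].
    by rewrite (topkeys_anc (subseq_uniq subA uT) xy yt).
  by move=> yB; rewrite dis' in yA.
- move=> x y xy; have [xB yB] := anc_mem xy; rewrite !ttau => /orP[/topkeys_inorder|yt].
    by rewrite dis'.
  by rewrite (topkeys_anc (subseq_uniq subB uT) xy yt) orbT.
- by move=> a b aA bB; apply: switch; [exact: sA|exact: sB|rewrite aA dis'].
- move=> a b aA bB; have [|||z] := @switch b a; [exact: sB|exact: sA|by rewrite aA dis'|].
  by case=> zt zb; rewrite betweenC => btw; exists z.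
Qed.

(* A point [(c, s)] reads: column [c] is touched while key [s] is accessed. *)
Definition third_point f (P : seq (nat * nat)) (c s d t : nat) : Prop :=
  exists e z : nat, [/\ (e, z) \in P, c <= e <= d, between f s z t,
                  (e, z) <> (c, s) & (e, z) <> (d, t)].

Lemma third_point_sub f P Q c s d t : {subset P <= Q} ->
  third_point f P c s d t -> third_point f Q c s d t.
Proof. by move=> PQ [e [z [/PQ ? ? ? ? ?]]]; exists e, z. Qed.

(** [sat_left] and [sat_right] strengthen the induction: they supply third points when one key is an
    ancestor of the other. The column range includes [hi], so neighbouring intervals share a
    column. *)
Record satisfied f T lo hi (P : seq (nat * nat)) : Prop := Satisfied {
  sat_range (c s : nat) : (c, s) \in P -> lo <= c <= hi /\ s \in inorder T;
  sat_diag (s : nat) : s \in inorder T -> (s, s) \in P;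
  sat_left (s d t : nat) : (d, t) \in P -> anc T s t -> exists2 e, e <= d & (e, s) \in P;
  sat_right (s d t : nat) : (d, t) \in P -> anc T s t -> exists2 e, d <= e & (e, s) \in P;
  sat_third (c s d t : nat) : (c, s) \in P -> (d, t) \in P -> c < d -> s <> t ->
    third_point f P c s d t }.

(** Let [y] be the lowest common ancestor of [s] and [t]. If [y] is not [s], the point [(lo, y)]
    serves. Otherwise [sat_left] gives [(e, s)] with [e <= d]: it serves if [lo < e], while [e = lo]
    puts both points in [P]. *)
Lemma third_point_lo f T lo hi P Q s d t : increasing f (inorder T) ->
  satisfied f T lo hi P -> {subset P <= Q} ->
  (d, t) \in P -> lo < d -> s <> t -> s \in inorder T ->
  (forall y, anc T y s -> (lo, y) \in Q) \/ (lo, s) \in P ->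
  third_point f Q lo s d t.
Proof.
move=> inc sat PQ dP lod st sT [loQ|loP]; last first.
  by apply: third_point_sub PQ _; apply: sat_third sat _ _ _ _ loP dP lod st.
have [rd tT] := sat_range sat dP.
have [y [ys yt btw]] := common_ancestor inc sT tT.
have [e|/eqP ne] := eqVneq y s.
  subst y; have [e ed eP] := sat_left sat dP yt.
  have [re _] := sat_range sat eP.
  have [elo|/eqP nlo] := eqVneq e lo.
    subst e; apply: third_point_sub PQ _.
    by apply: sat_third sat _ _ _ _ eP dP lod st.
  exists e, s; split; [exact: PQ|lia|by []|by case|by case].
exists lo, y; split; [exact: loQ|lia|by []|by case|case; lia].
Qed.

(** Mirror image, with [sat_right] on the upper border column. *)
Lemma third_point_hi f T lo hi P Q c s t : increasing f (inorder T) ->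
  satisfied f T lo hi P -> {subset P <= Q} ->
  (c, s) \in P -> c < hi -> s <> t -> t \in inorder T ->
  (forall y, anc T y t -> (hi, y) \in Q) \/ (hi, t) \in P ->
  third_point f Q c s hi t.
Proof.
move=> inc sat PQ cP chi st tT [hiQ|hiP]; last first.
  by apply: third_point_sub PQ _; apply: sat_third sat _ _ _ _ cP hiP chi st.
have [rc sT] := sat_range sat cP.
have [y [ys yt btw]] := common_ancestor inc sT tT.
have [e|/eqP ne] := eqVneq y t.
  subst y; have [e ed eP] := sat_right sat cP ys.
  have [re _] := sat_range sat eP.
  have [ehi|/eqP nhi] := eqVneq e hi.
    subst e; apply: third_point_sub PQ _.
    by apply: sat_third sat _ _ _ _ cP eP chi st.
  exists e, t; split; [exact: PQ|lia|by []|by case => _ /esym|by case].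
exists hi, y; split; [exact: hiQ|lia|by []|case; lia|by case].
Qed.

Definition cross (cs ys : seq nat) : seq (nat * nat) := [seq (c, y) | c <- cs, y <- ys].

Lemma mem_cross (c y : nat) cs ys : ((c, y) \in cross cs ys) = (c \in cs) && (y \in ys).
Proof.
apply/allpairsP/andP=> [[[a b] /= [ac bc [-> ->]]]|[cc yy]] //.
by exists (c, y).
Qed.

(* [lia] is slow when it meets the membership hypotheses of [satisfied_cut]. *)
Ltac nat_lia :=
  repeat match goal with
  | H : is_true (_ <= _) |- _ => revert H
  | H : is_true ((_ <= _) && (_ <= _)) |- _ => revert H
  | H : _ = _ |- _ => revert H
  | H : _ <> _ |- _ => revert H
  end; clear; intros; lia.

Lemma size_cross cs ys : size (cross cs ys) = size cs * size ys.
Proof. exact: size_allpairs. Qed.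

(** The cases follow the position of the two columns relative to [lo], [k], [hi]. Keys on different
    sides are separated by a touched key, which supplies a point on one of these columns; keys on
    the same side fall back on the point set of that side, whose border columns are treated by
    [third_point_lo] and [third_point_hi]. *)
Lemma satisfied_cut f T TA TB tau lo k hi PA PB :
  increasing f (inorder T) -> increasing f (inorder TA) -> increasing f (inorder TB) ->
  cut f T TA TB tau ->
  lo < k -> k < hi -> satisfied f TA lo k PA -> satisfied f TB k hi PB ->
  satisfied f T lo hi (cross [:: lo; k; hi] tau ++ PA ++ PB).
Proof.
move=> inc incA incB C lok khi SA SB; set P := _ ++ _.
have PA_P : {subset PA <= P} by move=> x xA; rewrite !mem_cat xA orbT.
have PB_P : {subset PB <= P} by move=> x xB; rewrite !mem_cat xB !orbT.
have loP (y : nat) : y \in tau -> (lo, y) \in P by move=> yt; rewrite mem_cat mem_cross yt !inE eqxx.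
have kP (y : nat) : y \in tau -> (k, y) \in P by move=> yt; rewrite mem_cat mem_cross yt !inE eqxx orbT.
have hiP (y : nat) : y \in tau -> (hi, y) \in P by move=> yt; rewrite mem_cat mem_cross yt !inE eqxx !orbT.
have PE (c s : nat) : (c, s) \in P ->
  [\/ s \in tau /\ [\/ c = lo, c = k | c = hi],
      [/\ (c, s) \in PA, lo <= c <= k & s \in inorder TA] |
      [/\ (c, s) \in PB, k <= c <= hi & s \in inorder TB]].
  rewrite mem_cat mem_cross !inE mem_cat => /or3P[/andP[h st]|h|h].
  - constructor 1; split=> //.
    by case/or3P: h => /eqP; [constructor 1|constructor 2|constructor 3].
  - by constructor 2; have [] := sat_range SA h.
  - by constructor 3; have [] := sat_range SB h.
have range (c s : nat) : (c, s) \in P -> lo <= c <= hi /\ s \in inorder T.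
  case/PE=> [[/(cut_tau C) sT cE]|[_ cE sA]|[_ cE sB]].
  - by split=> //; case: cE => ->; nat_lia.
  - by rewrite (cut_mem C) sA; split=> //; nat_lia.
  - by rewrite (cut_mem C) sB orbT; split=> //; nat_lia.
have sides (t : nat) : t \in inorder T -> t \in inorder TA \/ t \in inorder TB.
  by rewrite (cut_mem C) => /orP.
have dis (x : nat) : x \in inorder TA -> x \in inorder TB -> False := @cut_disjoint _ _ _ _ _ C x.
split=> //.
- move=> s /sides[sA|sB]; [exact: PA_P (sat_diag SA sA)|exact: PB_P (sat_diag SB sB)].
- move=> s d t dP st; have [rd _] := range _ _ dP.
  (* If [s] is untouched, so is its descendant [t], and the ancestry persists in one output. *)
  have [stau|sn] := boolP (s \in tau); first by exists lo; [nat_lia|exact: loP].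
  case: (PE _ _ dP) => [[/(cut_anc C st) stau _]|[dA _ tA]|[dB _ tB]].
  + by rewrite stau in sn.
  + have [stA|/anc_mem[_ tB]] := cut_hang C st sn; last by case: (dis t).
    by have [e ed eP] := sat_left SA dA stA; exists e; last exact: PA_P.
  + have [/anc_mem[_ tA]|stB] := cut_hang C st sn; first by case: (dis t).
    by have [e ed eP] := sat_left SB dB stB; exists e; last exact: PB_P.
- move=> s d t dP st; have [rd _] := range _ _ dP.
  have [stau|sn] := boolP (s \in tau); first by exists hi; [nat_lia|exact: hiP].
  case: (PE _ _ dP) => [[/(cut_anc C st) stau _]|[dA _ tA]|[dB _ tB]].
  + by rewrite stau in sn.
  + have [stA|/anc_mem[_ tB]] := cut_hang C st sn; last by case: (dis t).
    by have [e ed eP] := sat_right SA dA stA; exists e; last exact: PA_P.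
  + have [/anc_mem[_ tA]|stB] := cut_hang C st sn; first by case: (dis t).
    by have [e ed eP] := sat_right SB dB stB; exists e; last exact: PB_P.
move=> c s d t cP dP cd st.
have [[rc sT] [rd tT]] := (range _ _ cP, range _ _ dP).
(* The separating key avoids [s] here and [t] in [switch2], depending on which point already stands
   on the column to be used. *)
have switch1 : (s \in inorder TA) != (t \in inorder TA) ->
    exists z : nat, [/\ z \in tau, z <> s & between f s z t].
  case: (sides _ sT) (sides _ tT) => [sA|sB] [tA|tB] // ne.
  - by rewrite sA tA in ne.
  - exact (cut_switchA C sA tB).
  - have [z [zt zs btw]] := cut_switchB C tA sB.
    by exists z; rewrite betweenC.
  - move: ne; case: (boolP (s \in _)) => [/dis/(_ sB)//|_].
    by case: (boolP (t \in _)) => [/dis/(_ tB)//|_].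
have switch2 : (s \in inorder TA) != (t \in inorder TA) ->
    exists z : nat, [/\ z \in tau, z <> t & between f s z t].
  case: (sides _ sT) (sides _ tT) => [sA|sB] [tA|tB] // ne.
  - by rewrite sA tA in ne.
  - exact (cut_switchB C sA tB).
  - have [z [zt zs btw]] := cut_switchA C tA sB.
    by exists z; rewrite betweenC.
  - move: ne; case: (boolP (s \in _)) => [/dis/(_ sB)//|_].
    by case: (boolP (t \in _)) => [/dis/(_ tB)//|_].
have bss : between f s s t by rewrite /between; nat_lia.
have btt : between f s t t by rewrite /between; nat_lia.
have notA (x : nat) : x \in inorder TB -> x \in inorder TA = false.
  by move=> xB; apply/negbTE/negP => /dis; apply.
have [ec|/eqP nclo] := eqVneq c lo.
  subst c.
  have [ttau|tn] := boolP (t \in tau).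
    by exists lo, t; split; [exact: loP|nat_lia|by []|by case => /esym|case; nat_lia].
  have [same|/switch1[z [zt zs btw]]] := eqVneq (s \in inorder TA) (t \in inorder TA); last first.
    by exists lo, z; split; [exact: loP|nat_lia|by []|by case|case; nat_lia].
  case: (PE _ _ dP) => [[ttau _]|[dA dk tA]|[dB dk tB]]; first by rewrite ttau in tn.
    rewrite tA in same.
    apply: (third_point_lo incA SA PA_P dA cd st same).
    case: (PE _ _ cP) => [[stau _]|[cA _ _]|[_ cE _]]; [left|by right|nat_lia].
    by move=> y ys; apply: loP; exact (cut_ancA C ys stau).
  rewrite (notA _ tB) in same.
  case: (PE _ _ cP) => [[stau _]|[_ _ sA]|[_ cE _]]; [|by rewrite sA in same|nat_lia].
  (* Both keys are in [TB], so [k <= d], and the touched key [s] has a point on column [k]. *)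
  by exists k, s; split; [exact: kP|nat_lia|by []|case; nat_lia|by case].
have [ed|/eqP ndhi] := eqVneq d hi.
  subst d.
  have [stau|sn] := boolP (s \in tau).
    by exists hi, s; split; [exact: hiP|nat_lia|by []|case; nat_lia|by case].
  have [same|/switch2[z [zt zs btw]]] := eqVneq (s \in inorder TA) (t \in inorder TA); last first.
    by exists hi, z; split; [exact: hiP|nat_lia|by []|case; nat_lia|by case].
  case: (PE _ _ cP) => [[stau _]|[cA ck sA]|[cB ck sB]]; first by rewrite stau in sn.
    rewrite sA in same.
    case: (PE _ _ dP) => [[ttau _]|[_ dE _]|[_ _ /notA]]; [|nat_lia|by rewrite -same].
    by exists k, t; split; [exact: kP|nat_lia|by []|by case => _ /esym|case; nat_lia].
  have tB : t \in inorder TB by case: (sides _ tT) => // tA; rewrite tA (notA _ sB) in same.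
  apply: (third_point_hi incB SB PB_P cB cd st tB).
  case: (PE _ _ dP) => [[ttau _]|[_ dE _]|[dB _ _]]; [left|nat_lia|by right].
  by move=> y ys; apply: hiP; exact (cut_ancB C ys ttau).
(* Now [lo < c] and [d < hi], so a point off column [k] must come from [PA] or [PB], according to
   its side of [k]. *)
have [ck|kc|ck] := ltngtP c k.
- case: (PE _ _ cP) => [[_ []]|[cA _ sA]|[_ cE _]]; [nat_lia|nat_lia|nat_lia| |nat_lia].
  have [dk|kd|dk] := ltngtP d k.
  + case: (PE _ _ dP) => [[_ []]|[dA _ tA]|[_ dE _]]; [nat_lia|nat_lia|nat_lia| |nat_lia].
    by apply: third_point_sub PA_P _; apply: sat_third SA _ _ _ _ cA dA cd st.
  + case: (PE _ _ dP) => [[_ []]|[_ dE _]|[dB _ tB]]; [nat_lia|nat_lia|nat_lia|nat_lia|].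
    have [z [zt zs btw]] := cut_switchA C sA tB.
    by exists k, z; split; [exact: kP|nat_lia|by []|case; nat_lia|case; nat_lia].
  + subst d; case: (sides _ tT) => [tA|tB].
      apply: (third_point_hi incA SA PA_P cA cd st tA).
      case: (PE _ _ dP) => [[ttau _]|[dA _ _]|[_ _ /notA]]; [left|by right|by rewrite tA].
      by move=> y ys; apply: kP; exact (cut_ancA C ys ttau).
    have [z [zt zs btw]] := cut_switchB C sA tB.
    by exists k, z; split; [exact: kP|nat_lia|by []|case; nat_lia|by case].
- case: (PE _ _ cP) => [[_ []]|[_ cE _]|[cB _ sB]]; [nat_lia|nat_lia|nat_lia|nat_lia|].
  case: (PE _ _ dP) => [[_ []]|[_ dE _]|[dB _ tB]]; [nat_lia|nat_lia|nat_lia|nat_lia|].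
  by apply: third_point_sub PB_P _; apply: sat_third SB _ _ _ _ cB dB cd st.
subst c; case: (PE _ _ dP) => [[_ []]|[_ dE _]|[dB _ tB]]; [nat_lia|nat_lia|nat_lia|nat_lia|].
case: (sides _ sT) => [sA|sB].
  have [|z [zt zs btw]] := switch1; first by rewrite sA notA.
  by exists k, z; split; [exact: kP|nat_lia|by []|by case|case; nat_lia].
apply: (third_point_lo incB SB PB_P dB cd st sB).
case: (PE _ _ cP) => [[stau _]|[_ _ /dis/(_ sB)//]|[cB _ _]]; [left|by right].
by move=> y ys; apply: kP; exact (cut_ancB C ys stau).
Qed.

Lemma ptsort_satisfied f T a lo hi : ptsort T a ->
  (forall x, (x \in inorder T) = (lo <= x < hi)) -> increasing f (inorder T) ->
  exists2 P, satisfied f T lo hi P & size P <= 3 * a + size (inorder T).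
Proof.
move=> sorts; elim: sorts lo hi => {T a}
    [x|T tau TA TB k ca cb part ltA geB _ IHA _ IHB] lo hi keysT inc.
  have /andP[lox xhi] : lo <= x < hi by rewrite -keysT mem_head.
  have xlo : x = lo.
    have : lo \in inorder (Node Leaf x Leaf) by rewrite keysT; lia.
    by rewrite inE => /eqP.
  exists [:: (x, x)] => //; split.
  - by move=> c s; rewrite !inE => /eqP[-> ->]; rewrite eqxx; lia.
  - by move=> s; rewrite !inE => /eqP ->.
  - move=> s d t; rewrite !inE => /eqP[-> ->] /anc_mem[].
    by rewrite inE => /eqP -> _; exists x; rewrite ?inE.
  - move=> s d t; rewrite !inE => /eqP[-> ->] /anc_mem[].
    by rewrite inE => /eqP -> _; exists x; rewrite ?inE.
  - by move=> c s d t; rewrite !inE => /eqP[_ ->] /eqP[_ ->].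
have C := btpart_cut inc part.
case: part => _ [neA [neB [_ [_ [_ [subA subB]]]]]].
have [incA incB] := (subseq_pairwise subA inc, subseq_pairwise subB inc).
have root_mem t : t <> Leaf -> exists x, x \in inorder t.
  by case: t => // l x r _; exists x; rewrite mem_cat mem_head orbT.
(* Both outputs are nonempty, so [k] is strictly inside the interval. *)
have lok : lo < k.
  have [x xA] := root_mem _ neA; have := ltA _ xA.
  have := keysT x; rewrite (cut_mem C) xA; lia.
have khi : k < hi.
  have [x xB] := root_mem _ neB; have := geB _ xB.
  have := keysT x; rewrite (cut_mem C) xB orbT; lia.
have keysA x : (x \in inorder TA) = (lo <= x < k).
  apply/idP/andP=> [xA|[lox xk]].
    by have := keysT x; rewrite (cut_mem C) xA ltA //; lia.
  have : x \in inorder T by rewrite keysT; lia.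
  by rewrite (cut_mem C) => /orP[//|/geB]; lia.
have keysB x : (x \in inorder TB) = (k <= x < hi).
  apply/idP/andP=> [xB|[kx xhi]].
    by have := keysT x; rewrite (cut_mem C) xB orbT geB //; lia.
  have : x \in inorder T by rewrite keysT; lia.
  by rewrite (cut_mem C) => /orP[/ltA|//]; lia.
have [PA SA sizeA] := IHA _ _ keysA incA.
have [PB SB sizeB] := IHB _ _ keysB incB.
exists (cross [:: lo; k; hi] (topkeys tau T) ++ PA ++ PB);
  first exact: (satisfied_cut inc incA incB C lok khi SA SB).
(* The outputs are disjoint, so the counts of singleton points add up. *)
have sizeT : size (inorder TA ++ inorder TB) <= size (inorder T).
  apply: uniq_leq_size => [|x].
    rewrite cat_uniq (increasing_uniq incA) (increasing_uniq incB) andbT.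
    by apply/hasPn => x xB; apply/negP => xA; apply: cut_disjoint C _ xA xB.
  by rewrite mem_cat (cut_mem C).
by rewrite size_cat in sizeT; rewrite size_cat size_cross size_cat /=; lia.
Qed.

(** Each partition touches a key, and reaching singletons takes one partition fewer than there are
    keys. This absorbs the additive [n]. *)
Lemma ptsort_size f T a : ptsort T a -> increasing f (inorder T) ->
  size (inorder T) <= a.+1.
Proof.
elim=> {T a} // T tau TA TB k ca cb part _ _ _ IHA _ IHB inc.
have C := btpart_cut inc part.
case: part => top [_ [_ [_ [_ [_ [subA subB]]]]]].
have sA := IHA (subseq_pairwise subA inc); have sB := IHB (subseq_pairwise subB inc).
have : 0 < size (topkeys tau T).
  by case: tau T top {inc C subA subB} => // ? ? [] //= *; rewrite size_cat /= addnS.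
have : size (inorder T) <= size (inorder TA ++ inorder TB).
  apply: uniq_leq_size (increasing_uniq inc) _ => x.
  by rewrite mem_cat (cut_mem C).
by rewrite size_cat; lia.
Qed.

(** * Rotating one top tree into another *)

Lemma walk_trans t p c t1 p1 c' t2 p2 :
  walk t p c t1 p1 -> walk t1 p1 c' t2 p2 -> walk t p (c + c') t2 p2.
Proof. by elim=> // *; rewrite addSn; apply: wS; eauto. Qed.

Lemma walk_right l k t p c t' p' : walk t p c t' p' ->
  walk (Node l k t) (true :: p) c (Node l k t') (true :: p').
Proof.
elim=> {t p c t' p'} [*|t p t1 p1 c t2 p2 st _ IH]; first exact: w0.
apply: wS IH; case: st => {t p t1 p1 t2 p2} [t q b h|t p b l' k' r' h h'|t q b h].
- exact: (@st_up (Node l k t) (true :: q) b).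
- exact: (@st_down (Node l k t) (true :: p) b _ _ _ h h').
- exact: (@st_rot (Node l k t) (true :: q) b).
Qed.

Lemma sub_at_nil t : sub_at t [::] = t.
Proof. by case: t. Qed.

Lemma sub_at_rcons t p b : sub_at t (rcons p b) =
  if sub_at t p is Node l _ r then if b then r else l else Leaf.
Proof.
by elim: p t => [|b' p IH] [|l k r] //=; rewrite sub_at_nil.
Qed.

Lemma walk_down_up t p : sub_at t p <> Leaf ->
  walk t [::] (size p) t p /\ walk t p (size p) t [::].
Proof.
elim/last_ind: p => [|p b IH] h; first by split; exact: w0.
case e: (sub_at t p) => [|l k r]; first by rewrite sub_at_rcons e in h.
have [dn up] := IH ltac:(by rewrite e); rewrite size_rcons; split; last first.
  by apply: wS up; apply: st_up.
rewrite -addn1; apply: walk_trans dn (wS _ (w0 _ _)).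
by rewrite sub_at_rcons e in h; exact: (st_down e h).
Qed.

Definition loop (c : nat) (t t' : bt) : Prop :=
  exists2 c', c' <= c & walk t [::] c' t' [::].

(** Both directions are kept so that the straightening of the target shape can be run backwards. *)
Definition convertible (c : nat) (t t' : bt) : Prop := loop c t t' /\ loop c t' t.

Lemma convertible_refl c t : convertible c t t.
Proof. by split; exists 0 => //; exact: w0. Qed.

Lemma convertible_sym c t t' : convertible c t t' -> convertible c t' t.
Proof. by case. Qed.

Lemma convertible_trans c c' t1 t2 t3 :
  convertible c t1 t2 -> convertible c' t2 t3 -> convertible (c + c') t1 t3.
Proof.
case=> -[a1 h1 w1] [a2 h2 w2] [[b1 g1 v1] [b2 g2 v2]]; split.
  by exists (a1 + b1); [exact: leq_add|exact: walk_trans w1 v1].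
by exists (b2 + a2); [rewrite addnC leq_add|exact: walk_trans v2 w2].
Qed.

Lemma convertible_right c l k t t' : t <> Leaf -> t' <> Leaf ->
  convertible c t t' -> convertible (c + 2) (Node l k t) (Node l k t').
Proof.
have go u u' : u <> Leaf -> u' <> Leaf -> loop c u u' ->
    loop (c + 2) (Node l k u) (Node l k u').
  move=> un un' [a ac w]; exists (1 + (a + 1)); first by lia.
  apply: walk_trans (wS _ (w0 _ _)) (walk_trans (walk_right l k w) (wS _ (w0 _ _))).
    exact: (@st_down (Node l k u) [::] true _ _ _ erefl un).
  by apply: (@st_up (Node l k u') [::] true); rewrite /= sub_at_nil.
by move=> tn tn' [w w']; split; exact: go.
Qed.

Lemma convertible_rot a x b y d :
  convertible 2 (Node (Node a x b) y d) (Node a x (Node b y d)).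
Proof.
split; exists 2 => //.
  apply: (wS _ (wS _ (w0 _ _))).
    exact: (@st_down (Node (Node a x b) y d) [::] false _ _ _ erefl).
  exact: (@st_rot (Node (Node a x b) y d) [::] false).
apply: (wS _ (wS _ (w0 _ _))).
  exact: (@st_down (Node a x (Node b y d)) [::] true _ _ _ erefl).
exact: (@st_rot (Node a x (Node b y d)) [::] true).
Qed.

(* [decomp t l h]: the tree [t] has a top tree with keys [unzip2 l] in order,
   below which hang the trees [unzip1 l] and [h], from left to right. *)
Inductive decomp : bt -> seq (bt * nat) -> bt -> Prop :=
| decomp_hang t : decomp t [::] t
| decomp_node a x b la ha lb hb : decomp a la ha -> decomp b lb hb ->
    decomp (Node a x b) (la ++ (ha, x) :: lb) hb.

Definition spine (l : seq (bt * nat)) (h : bt) : bt :=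
  foldr (fun p t => Node p.1 p.2 t) h l.

Lemma spine_cat l1 l2 h : spine (l1 ++ l2) h = spine l1 (spine l2 h).
Proof. exact: foldr_cat. Qed.

(** Four per key: two for the rotation lifting it above its parent, two for entering and leaving the
    right subtree. *)
Lemma decomp_spine_under t l h k r : decomp t l h ->
  convertible (4 * size l) (Node t k r) (spine l (Node h k r)).
Proof.
move=> dec; elim: dec k r => {t l h} [t|a x b la ha lb hb _ IHa _ IHb] k r.
  exact: convertible_refl.
rewrite spine_cat.
have -> : 4 * size (la ++ (ha, x) :: lb) = 2 + (4 * size lb + 2 + 4 * size la).
  by rewrite size_cat /=; lia.
apply: convertible_trans (convertible_rot _ _ _ _ _) _.
apply: convertible_trans (IHa x (spine lb (Node hb k r))).
by apply: convertible_right (IHb k r) => //; case: (lb).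
Qed.

Lemma decomp_nil t h : decomp t [::] h -> t = h.
Proof. by move El: [::] => l dec; case: dec El => // a x b [|p la]. Qed.

Lemma decomp_spine t l h : decomp t l h -> convertible (4 * size l) t (spine l h).
Proof.
elim=> {t l h} [t|a x b la ha lb hb deca _ decb IHb]; first exact: convertible_refl.
have -> : 4 * size (la ++ (ha, x) :: lb) = (4 * size lb + 2) + (4 * size la + 2).
  by rewrite size_cat /=; lia.
rewrite spine_cat; apply: (@convertible_trans _ _ _ (Node a x (spine lb hb))).
  (* Without top keys on the right there is nothing to straighten, and the hanging tree may be
     [Leaf], which the pointer cannot enter. *)
  case: lb decb IHb => [/decomp_nil ->|p lb decb IHb].
    by split; exists 0 => //; exact: w0.
  by apply: convertible_right IHb => // e; rewrite e in decb; inversion decb.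
case: (decomp_spine_under x (spine lb hb) deca) => -[c1 h1 w1] [c2 h2 w2].
by split; [exists c1|exists c2] => //; lia.
Qed.

Lemma decomp_visit t l h y : decomp t l h -> y \in unzip2 l ->
  exists p a b, size p <= size l /\ sub_at t p = Node a y b.
Proof.
elim=> {t l h} // a x b la ha lb hb _ IHa _ IHb.
rewrite /unzip2 map_cat mem_cat in_cons size_cat /= => /or3P[/IHa|/eqP ->|/IHb].
- by case=> p [a' [b' [sp e]]]; exists (false :: p), a', b'; split=> //=; lia.
- by exists [::], a, b.
- by case=> p [a' [b' [sp e]]]; exists (true :: p), a', b'; split=> //=; lia.
Qed.

(** Ten per key: two for walking down to [y] and back, four to reach the spine, four from there to
    the new shape. *)
Lemma search_restructure t t' l h y : decomp t l h -> decomp t' l h ->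
  y \in unzip2 l -> exists2 c, c <= 10 * size l & search t y c t'.
Proof.
move=> dec dec' yl; have [p [a [b [sp e]]]] := decomp_visit dec yl.
have [|dn up] := @walk_down_up t p; first by rewrite e.
have [[c cl w] _] := convertible_trans (decomp_spine dec)
  (convertible_sym (decomp_spine dec')).
exists (size p + (size p + c)); first by lia.
by exists (size p), (size p + c), t, p, [::]; split=> //; [exists a, b|exact: walk_trans up w].
Qed.

(** * Treaps on the next touch time *)

Fixpoint keys (l : seq (bt * nat)) (h : bt) : seq nat :=
  if l is (a, k) :: l' then inorder a ++ k :: keys l' h else inorder h.

Lemma keys_cat l1 a k l2 h : keys (l1 ++ (a, k) :: l2) h = keys l1 a ++ k :: keys l2 h.
Proof. by elim: l1 => [|[b x] l IH] //=; rewrite IH -catA. Qed.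

Lemma decomp_inorder t l h : decomp t l h -> inorder t = keys l h.
Proof. by elim=> // a x b la ha lb hb _ /= -> _ ->; rewrite keys_cat. Qed.

Fixpoint heap (N : nat -> nat) (t : bt) : bool :=
  if t is Node l k r then
    [&& all (fun x => N k <= N x) (inorder l ++ inorder r), heap N l & heap N r]
  else true.

(** An access that leaves a column untouched brings its next touch one step closer, so untouched
    hanging trees stay heaps. *)
Lemma heap_succ N N' t : (forall x, x \in inorder t -> N x = (N' x).+1) ->
  heap N t -> heap N' t.
Proof.
elim: t => //= l IHl k r IHr NN' /and3P[/allP kmin hl hr].
have NN x : x \in inorder l ++ inorder r -> N x = (N' x).+1.
  by move=> xi; apply: NN'; move: xi; rewrite !mem_cat in_cons => /orP[] ->; rewrite ?orbT.
apply/and3P; split.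
- apply/allP => x xi; have := kmin x xi.
  by rewrite (NN x xi) NN' // mem_cat mem_head orbT.
- by apply: IHl hl => x xi; apply: NN; rewrite mem_cat xi.
- by apply: IHr hr => x xi; apply: NN; rewrite mem_cat xi orbT.
Qed.

Definition first_hang (l : seq (bt * nat)) (h : bt) : bt := head h (unzip1 l).

(* A tree hanging between two neighbouring keys of [l] becomes a child of whichever
   of them ends up lower, so its keys must have priorities at least those of both. *)
Fixpoint mergeable (N : nat -> nat) (l : seq (bt * nat)) (h : bt) : bool :=
  if l is (a, k) :: l' then
    [&& heap N a, all (fun x => N k <= N x) (inorder a),
        all (fun x => N k <= N x) (inorder (first_hang l' h)) & mergeable N l' h]
  else heap N h.

Lemma mergeable_cat N l1 a k l2 h : mergeable N (l1 ++ (a, k) :: l2) h ->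
  mergeable N l1 a /\ mergeable N l2 h.
Proof.
elim: l1 => [|[b x] l1 IH] /=; first by case/and4P.
case/and4P=> -> -> first_ok /IH[m1 m2]; split=> //; rewrite m1 andbT.
by case: l1 first_ok {IH m1} => [|[]].
Qed.

Lemma mergeable_min N m l h : mergeable N l h -> 0 < size l ->
  all (fun k => m <= N k) (unzip2 l) -> all (fun x => m <= N x) (keys l h).
Proof.
elim: l => [|[a k] l IH] //= /and4P[_ ka kf ml] _ /andP[mk mlk].
have trans s : all (fun x => N k <= N x) s -> all (fun x => m <= N x) s.
  by apply: sub_all => x; apply: leq_trans.
rewrite all_cat trans //= mk /=.
by case: l IH kf ml mlk => [|p l] IH kf ml mlk; [exact: trans|exact: IH].
Qed.

Lemma split_min (N : nat -> nat) (l : seq (bt * nat)) : 0 < size l ->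
  exists l1 a k l2, l = l1 ++ (a, k) :: l2 /\ all (fun x => N k <= N x) (unzip2 l).
Proof.
elim: l => [|[a k] [|p l] IH] // _.
  by exists [::], a, k, [::]; rewrite /= leqnn.
have [//|l1 [b [x [l2 [e xmin]]]]] := IH.
have [le|/ltnW le] := leqP (N k) (N x).
  exists [::], a, k, (p :: l); split; rewrite // /= leqnn.
  by apply: sub_all xmin => z; apply: leq_trans.
by exists ((a, k) :: l1), b, x, l2; rewrite e; split; rewrite // -e [X in all _ X]/= /= le.
Qed.

(** Cartesian tree construction: a top key of least priority becomes the root, and both sides are
    handled recursively. *)
Lemma mergeable_heap N l h : mergeable N l h -> exists2 t, decomp t l h & heap N t.
Proof.
have [n] := ubnP (size l); elim: n l h => // n IH l h sn ml.
have [/size0nil e|ne] := posnP (size l); first by subst l; exists h; [exact: decomp_hang|].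
have [l1 [a [k [l2 [e kmin]]]]] := split_min N ne.
have := mergeable_min ml ne kmin.
subst l; rewrite keys_cat all_cat /= => /and3P[k1 _ k2].
have [m1 m2] := mergeable_cat ml.
rewrite size_cat /= in sn.
have [|t1 d1 h1] := IH l1 a _ m1; first by lia.
have [|t2 d2 h2] := IH l2 h _ m2; first by lia.
exists (Node t1 k t2); first exact: decomp_node.
by rewrite /= all_cat (decomp_inorder d1) (decomp_inorder d2) k1 k2 h1 h2.
Qed.

Fixpoint top_exactly (q : pred nat) (N : nat -> nat) (l : seq (bt * nat)) (h : bt) : bool :=
  if l is (a, k) :: l' then
    [&& q k, heap N a, all (predC q) (inorder a) & top_exactly q N l' h]
  else heap N h && all (predC q) (inorder h).

Lemma top_exactly_cat q N l1 a k l2 h : top_exactly q N l1 a -> q k ->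
  top_exactly q N l2 h -> top_exactly q N (l1 ++ (a, k) :: l2) h.
Proof.
elim: l1 => [|[b x] l IH] /=; first by case/andP=> -> -> -> ->.
by case/and4P=> -> -> -> m qk m2; rewrite IH.
Qed.

Lemma top_exactly_count q N l h : top_exactly q N l h -> count q (keys l h) = size l.
Proof.
have zero s : all (predC q) s -> count q s = 0.
  by rewrite all_predC has_count -leqNgt leqn0 => /eqP.
elim: l => [|[a k] l IH] /=; first by case/andP=> _ /zero.
by case/and4P=> qk _ /zero ea /IH e; rewrite count_cat /= ea qk e.
Qed.

Lemma top_exactly_keys q N l h y : top_exactly q N l h -> q y -> y \in keys l h ->
  y \in unzip2 l.
Proof.
move=> + qy; elim: l => [|[a k] l IH] /=.
  by case/andP=> _ /allP no /no /=; rewrite qy.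
case/and4P=> _ _ /allP no /IH ih; rewrite mem_cat !in_cons.
by case/or3P=> [/no /=|->|/ih ->]; rewrite ?qy ?orbT.
Qed.

(** Priority zero marks the columns touched now; below a key of positive priority all priorities are
    positive, so the zero keys form a top part. *)
Lemma heap_top (q : pred nat) N t : (forall x, (N x == 0) = q x) -> heap N t ->
  exists l h, decomp t l h /\ top_exactly q N l h.
Proof.
move=> Nq; elim: t => [|l IHl k r IHr] ht.
  by exists [::], Leaf; split; first exact: decomp_hang.
have [qk|nqk] := boolP (q k).
  case/and3P: ht => _ /IHl[la [ha [da ta]]] /IHr[lb [hb [db tb]]].
  exists (la ++ (ha, k) :: lb), hb; split; first exact: decomp_node.
  exact: top_exactly_cat.
exists [::], (Node l k r); split; first exact: decomp_hang.
rewrite /top_exactly ht /=; move: ht => /= /and3P[+ _ _].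
rewrite !all_cat /= nqk /= => /andP[hl hr]; apply/andP; split.
  by apply: sub_all hl => x /=; rewrite -Nq; move: nqk; rewrite -Nq; lia.
by apply: sub_all hr => x /=; rewrite -Nq; move: nqk; rewrite -Nq; lia.
Qed.

Lemma iota_cat_cons m p s1 k s2 : iota m p = s1 ++ k :: s2 ->
  [/\ s1 = iota m (size s1), k = m + size s1 & s2 = iota k.+1 (size s2)].
Proof.
move=> e; have := congr1 size e; rewrite size_iota size_cat /= => sp.
move: e; rewrite sp iotaD => /eqP; rewrite eqseq_cat ?size_iota //=.
by case/andP=> /eqP <- /eqP[<- <-]; rewrite !size_iota.
Qed.

(** The keys are consecutive, so a hanging tree fills the gap next to a touched column [c], and no
    other touched column lies between [c] and its keys. *)
Lemma top_exactly_mergeable q N N' m p l h : keys l h = iota m p ->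
  (forall x, ~~ q x -> N x = (N' x).+1) ->
  (forall c d, q c -> (forall e, between id c e d -> e <> c -> ~~ q e) -> N' c <= N' d) ->
  top_exactly q N l h -> mergeable N' l h.
Proof.
move=> + NN' adj; elim: l m p => [|[a k] l IH] m p /=.
  by move=> _ /andP[hh /allP no]; apply: heap_succ hh => x /no /NN'.
move/esym => ks /and4P[qk ha /allP no top].
have [ea ek el] := iota_cat_cons ks.
apply/and4P; split.
- by apply: heap_succ ha => x /no /NN'.
- apply/allP => d dA; apply: adj => // e ced ec; apply: no.
  by move: dA; rewrite ea !mem_iota; move: ced; rewrite /between /=; lia.
- have [no' [s2 e2]] : all (predC q) (inorder (first_hang l h)) /\
      exists s2, keys l h = inorder (first_hang l h) ++ s2.
    case: (l) top => [/andP[_ ->]|[b x] l' /= /and4P[_ _ -> _]]; split=> //.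
      by exists [::]; rewrite cats0.
    by exists (x :: keys l' h).
  apply/allP => d df; apply: adj => // e ced ec; apply: (allP no').
  have e1 : inorder (first_hang l h) = iota k.+1 (size (inorder (first_hang l h))).
    move: el; rewrite e2 size_cat iotaD => /eqP; rewrite eqseq_cat ?size_iota //.
    by case/andP=> /eqP.
  by move: df; rewrite e1 !mem_iota; move: ced; rewrite /between /=; lia.
- exact: IH el top.
Qed.

(** A column never touched again gets [size s], the largest possible priority. *)
Definition next_touch (P : seq (nat * nat)) (s : seq nat) (c : nat) : nat :=
  find (fun y => (c, y) \in P) s.

(* If [d] were touched strictly before [c], satisfaction would yield a touched
   point ever closer to column [c]. *)
Lemma next_touch_le (P : seq (nat * nat)) (pi pre s : seq nat) (y c d : nat) :
  uniq pi -> pi = pre ++ y :: s ->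
  (forall c s d t : nat, (c, s) \in P -> (d, t) \in P -> c < d -> s <> t ->
     third_point (index^~ pi) P c s d t) ->
  (c, y) \in P -> (forall e, between id c e d -> e <> c -> (e, y) \notin P) ->
  next_touch P s c <= next_touch P s d.
Proof.
move=> upi epi sat cP.
have sat' (d' t : nat) : (d', t) \in P -> c <> d' -> y <> t -> exists e z : nat,
    [/\ (e, z) \in P, between id c e d', between (index^~ pi) y z t,
        (e, z) <> (c, y) & (e, z) <> (d', t)].
  move=> dP /eqP; rewrite neq_ltn => /orP[cd|dc] yt.
    have [e [z [eP ced btw n1 n2]]] := sat _ _ _ _ cP dP cd yt.
    by exists e, z; split=> //; rewrite /between ced.
  have [e [z [eP ced btw n1 n2]]] := sat _ _ _ _ dP cP dc (nesym yt).
  by exists e, z; split=> //; rewrite 1?betweenC // /between ced.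
have next_min e j : j < size s -> (e, nth 0 s j) \in P -> next_touch P s e <= j.
  by move=> js eP; rewrite leqNgt; apply/negP => /(before_find 0); rewrite eP.
(* The truncated differences sum to the distance of the columns, the induction measure. *)
have [n] := ubnP ((c - d) + (d - c)); elim: n d => // n IH d dn free.
have [->//|/eqP ncd] := eqVneq c d.
rewrite leqNgt; apply/negP => lt.
pose i := next_touch P s d; have is_ : i < size s by apply: leq_trans lt (find_size _ _).
have dP : (d, nth 0 s i) \in P by apply: (@nth_find _ 0 (fun x => (d, x) \in P) s); rewrite has_find.
have y_nth : nth 0 pi (size pre) = y by rewrite epi nth_cat ltnn subnn.
(* The suffix [s] starts one place after [y], hence [j.+1]. *)
have s_nth j : nth 0 pi (size pre + j.+1) = nth 0 s j.
  by rewrite epi nth_cat ltnNge leq_addr /= addKn.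
have size_pi : size pi = size pre + (size s).+1 by rewrite epi size_cat.
have iy : index y pi = size pre by rewrite -y_nth index_uniq // size_pi; lia.
have iz : index (nth 0 s i) pi = size pre + i.+1.
  by rewrite -s_nth index_uniq // size_pi; lia.
have yz : y <> nth 0 s i by move=> e; move: iz; rewrite -e iy; lia.
have [e [w [eP ced btw n1 n2]]] := sat' _ _ dP ncd yz.
rewrite /between /= iy iz in btw.
have wpi : w \in pi by rewrite -index_mem size_pi; lia.
(* A third point in the row of [y] would be [(c, y)] itself or contradict [free]. *)
have [iw|niw] := eqVneq (index w pi) (size pre).
  have wy : w = y by rewrite -y_nth -iw nth_index.
  subst w; case: (eqVneq e c) => [ec|/eqP/(free _ ced)/negP//].
  by subst e.
pose j := index w pi - (size pre).+1.
have ew : w = nth 0 s j by rewrite -s_nth -[LHS](nth_index 0 wpi); congr nth; rewrite /j; lia.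
have ji : j <= i by rewrite /j; lia.
have js : j < size s by lia.
rewrite ew in eP n2; have nj := next_min _ _ js eP.
have [ec|/eqP nec] := eqVneq e c; first by subst e; rewrite -/i in lt; lia.
have [ed|/eqP ned] := eqVneq e d.
  subst e; have ij : i = j by rewrite -/i in nj; lia.
  by rewrite -ij in n2.
have sub : forall x, between id c x e -> between id c x d.
  by move: ced; rewrite /between /=; lia.
have := IH e _ (fun x cxe => free x (sub x cxe)).
have: (c - e) + (e - c) < n by move: ced; rewrite /between /=; lia.
by move=> h /(_ h); rewrite -/i in lt; lia.
Qed.

(** Invariant: after the accesses [pre], the tree is a heap for the next touches within the
    remaining [s]. *)
Lemma serve_satisfied (P : seq (nat * nat)) (pi : seq nat) n : uniq pi ->
  (forall c s d t : nat, (c, s) \in P -> (d, t) \in P -> c < d -> s <> t ->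
     third_point (index^~ pi) P c s d t) ->
  (forall y : nat, y \in pi -> 1 <= y <= n /\ (y, y) \in P) ->
  forall s pre t, pi = pre ++ s -> inorder t = iota 1 n -> heap (next_touch P s) t ->
  exists2 c, c <= 10 * sumn [seq count (fun c => (c, y) \in P) (iota 1 n) | y <- s]
           & serve t s c.
Proof.
move=> upi sat diag; elim=> [|y s IH] pre t epi it ht; first by exists 0; [|exact: sv_nil].
pose q := [pred c | (c, y) \in P].
have [l [h [dec top]]] : exists l h, decomp t l h /\ top_exactly q (next_touch P (y :: s)) l h.
  by apply: heap_top ht => x; rewrite /next_touch /q /=; case: ifP.
have kl := decomp_inorder dec; rewrite it in kl.
have [t' dec' ht'] : exists2 t', decomp t' l h & heap (next_touch P s) t'.
  apply: mergeable_heap; apply: top_exactly_mergeable (esym kl) _ _ top.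
    by move=> x; rewrite /q /next_touch /= => /negbTE ->.
  by move=> c d cq free; apply: next_touch_le upi epi sat cq free.
have [yn yP] : 1 <= y <= n /\ (y, y) \in P by apply: diag; rewrite epi mem_cat mem_head orbT.
have yl : y \in unzip2 l.
  by apply: top_exactly_keys top yP _; rewrite -kl mem_iota; lia.
have [c1 c1l se] := search_restructure dec dec' yl.
have [||c2 c2l sv] := IH (rcons pre y) t' _ _ ht'.
- by rewrite cat_rcons.
- by rewrite (decomp_inorder dec').
exists (c1 + c2); last exact: sv_cons se sv.
by have := top_exactly_count top; rewrite -kl /= => ->; rewrite mulnDr leq_add.
Qed.

(** * Counting touched points and assembling the bound *)

Lemma sum_columns (P : seq (nat * nat)) cs s : uniq cs -> uniq s ->
  sumn [seq count (fun c => (c, y) \in P) cs | y <- s] <= size P.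
Proof.
move=> ucs; elim: s P => //= y s IH P /andP[ys us].
pose here := [pred p : nat * nat | p.2 == y].
have -> : size P = size [seq p <- P | here p] + size [seq p <- P | ~~ here p].
  by rewrite !size_filter count_predC.
apply: leq_add.
  rewrite -size_filter -(size_map (fun c => (c, y))); apply: uniq_leq_size.
    by rewrite map_inj_uniq ?filter_uniq // => a b [].
  move=> p /mapP[c]; rewrite mem_filter => /andP[cP _] ->.
  by rewrite mem_filter /= eqxx.
apply: leq_trans (IH _ us); rewrite leq_eqVlt; apply/orP; left; apply/eqP.
congr sumn; apply/eq_in_map => z zs; apply: eq_count => c /=.
rewrite mem_filter /=; case: eqVneq => // e.
by rewrite -e zs in ys.
Qed.

(** With empty hanging trees, [mergeable] holds for any priorities. *)
Lemma exists_heap N m p : exists2 t, inorder t = iota m p & heap N t.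
Proof.
pose l := [seq (Leaf, k) | k <- iota m p].
have ml : mergeable N l Leaf.
  by rewrite /l; elim: (iota m p) => //= k s IH; rewrite IH; case: (s).
have [t dec ht] := mergeable_heap ml; exists t => //.
by rewrite (decomp_inorder dec) /l; elim: (iota m p) => //= k s ->.
Qed.

Theorem theorem5 :
  exists C : nat, forall (n : nat) (pi : seq nat) (T : bt) (a : nat),
    perm_eq pi (iota 1 n) -> inorder T = pi -> ptsort T a ->
    opt_bst_le n pi (C * a).
Proof.
(* The cost is at most [10 * (3 * a + n)], and [n <= a + 1 <= 2 * a] once [a > 0]. *)
exists 50 => n pi T a perm iT sorts.
have upi : uniq pi by rewrite (perm_uniq perm) iota_uniq.
have mempi y : (y \in pi) = (1 <= y < n.+1) by rewrite (perm_mem perm) mem_iota add1n.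
have sizepi : size pi = n by rewrite (perm_size perm) size_iota.
have inc : increasing (index^~ pi) (inorder T).
  rewrite iT; apply/(pairwiseP 0) => i j; rewrite !inE => si sj ij.
  by rewrite !index_uniq.
have := ptsort_size sorts inc; rewrite iT sizepi => na.
(* With [a = 0] at most one key remains; it sits at the root, so its search is free. *)
have [a0|a_gt0] := posnP a.
  subst a; case: n perm mempi sizepi na => [|[|//]] perm mempi sizepi _.
    by move/size0nil: sizepi => ->; exists Leaf; split=> //; exists 0; split; [exact: sv_nil|].
  have [x ex] : exists x, pi = [:: x] by case: (pi) sizepi => [|x []] // _; exists x.
  have : x \in pi by rewrite ex mem_head.
  rewrite mempi => x1; have {x1} ex1 : x = 1 by lia.
  subst x; exists (Node Leaf 1 Leaf); split=> //; exists 0; split=> //; rewrite ex.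
  apply: (@sv_cons _ _ _ 0 _ 0 _ (sv_nil _)).
  exists 0, 0, (Node Leaf 1 Leaf), [::], [::]; split=> //; try exact: w0.
  by exists Leaf, Leaf.
(* [P] may touch the border column [n.+1], which is no key; the serving cost counts columns [1] to
   [n]. *)
have keysT x : (x \in inorder T) = (1 <= x < n.+1) by rewrite iT mempi.
have [P S sizeP] := ptsort_satisfied sorts keysT inc.
rewrite iT sizepi in sizeP.
have [t0 it0 ht0] := exists_heap (next_touch P pi) 1 n.
exists t0; split=> //.
have [||c cl sv] := @serve_satisfied P pi n upi (sat_third S) _ pi [::] t0 _ it0 ht0 => //.
  by move=> y ypi; split; [move: ypi; rewrite mempi; lia|apply: (sat_diag S); rewrite iT].
exists c; split=> //; apply: leq_trans cl _.
by have := sum_columns P (iota_uniq 1 n) upi; lia.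
Qed.
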